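(* There exists a unique formal power series $Q(x,a)\equiv Q(t,x,a)\in\mathbb{Z}[a,x][[t]]$ satisfying $$Q(x,a)=t(x+1)^2(1+a)^2+t(1+x)\frac{Q(x,a)-Q(x,0)}{a}\left((1+a)^2+a\,\frac{Q(x,a)-Q(0,a)}{x}\right)+t(1+x)\,a\,Q(x,a).$$ Moreover, the generating function $W(t)=\sum_{n\geq 1} w_n t^n$ of $3$-stack-sortable permutations is given by $W(t)=Q(t,0,0)$.
   Context: A permutation is an ordering of a finite set of positive integers; $S_n$ is the set of permutations of $\{1,\dots,n\}$. The stack-sorting map $s$ is defined recursively: $s$ sends the empty permutation to itself, and if $\pi$ is nonempty with largest entry $m$, written $\pi=LmR$ (concatenation), then $s(\pi)=s(L)\,s(R)\,m$. A permutation $\pi$ is $k$-stack-sortable if $s^k(\pi)$ (the $k$-fold iterate) is increasing. Let $w_n$ denote the number of $3$-stack-sortable permutations in $S_n$. The quotients $(Q(x,a)-Q(x,0))/a$ and $(Q(x,a)-Q(0,a))/x$ are understood as formal power series (polynomial division is exact). *)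

(* Defs.v *)
From mathcomp Require Import all_boot all_order all_algebra.
Set Implicit Arguments. Unset Strict Implicit. Unset Printing Implicit Defensive.
Import GRing.Theory.

(* Permutations are sequences of positive integers. *)
Definition maxseq (p : seq nat) : nat := foldr maxn 0 p.

(* s with fuel; with fuel >= size p it computes the stack-sorting map. *)
Fixpoint ssort_fuel (k : nat) (p : seq nat) : seq nat :=
  match k with
  | 0 => p
  | k.+1 =>
    match p with
    | [::] => [::]
    | _ :: _ =>
      let m := maxseq p in
      let i := index m p in
      ssort_fuel k (take i p) ++ ssort_fuel k (drop i.+1 p) ++ [:: m]
    end
  end.

Definition ssort (p : seq nat) : seq nat := ssort_fuel (size p) p.

Definition stack_sortable (k : nat) (p : seq nat) : bool :=
  sorted ltn (iter k ssort p).

Definition w (n : nat) : nat :=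
  count (stack_sortable 3) (permutations (iota 1 n)).

(* Z[a,x] is represented as {poly {poly int}}: outer variable a, inner x. *)
Local Open Scope ring_scope.
Definition R2 := {poly {poly int}}.
Definition varA : R2 := 'X.
Definition varX : R2 := ('X)%:P.

(* A series in Z[a,x][[t]]: n |-> coefficient of t^n. *)
Definition series := nat -> R2.

Definition smul (f g : series) : series :=
  fun n => \sum_(i < n.+1) f i * g (n - i)%N.

Definition tshift (f : series) : series :=
  fun n => if n is m.+1 then f m else 0.

Definition at_a0 (Q : series) : series := fun n => ((Q n)`_0)%:P.
Definition at_x0 (Q : series) : series :=
  fun n => map_poly (fun p : {poly int} => (p.[0])%:P) (Q n).

(* The functional equation, with the two quotients D1 = (Q(x,a)-Q(x,0))/a
   and D2 = (Q(x,a)-Q(0,a))/x given as exact quotients. *)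
Definition Qeq (Q : series) : Prop :=
  exists D1 D2 : series,
    (forall n, varA * D1 n = Q n - at_a0 Q n) /\
    (forall n, varX * D2 n = Q n - at_x0 Q n) /\
    (forall n, Q n =
       (n == 1%N)%:R * ((varX + 1) ^+ 2 * (1 + varA) ^+ 2)
       + tshift (fun m =>
            (1 + varX) * smul D1 (fun k => (k == 0%N)%:R * (1 + varA) ^+ 2
                                           + varA * D2 k) m
            + (1 + varX) * varA * Q m) n).

Definition coef00 (Q : series) (n : nat) : int := ((Q n)`_0).[0].

(* Main.v *)
Require Import Defs.
From Stdlib Require Import FunctionalExtensionality.
From mathcomp Require Import all_boot all_order all_algebra.
From mathcomp Require Import zify ring.
Set Implicit Arguments. Unset Strict Implicit. Unset Printing Implicit Defensive.
Import GRing.Theory.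

(** Let [Psi w] be the polynomial in [a] given by [Psi [::] = 1 + a] and, for [m]
  the maximum of [L m R], by [Psi (L m R)] = (Psi L - (Psi L)(0)) / a times
  [(1 + a)^2] if [R] is empty and [a * Psi R] otherwise.  Its constant term counts
  the preimages of [w] under [s], because the sum of [(Psi A)(0) * Psi B] over all
  factorizations [w = A B] is [(1 + a) (Psi w - (Psi w)(0)) / a].  Call [i] a cut of
  [B] if the first [i] entries of [B] are smaller than all the others.  Then the
  coefficient of [t^n] in [Q] is the sum of [Psi w * (1 + x)^(number of cuts of s w)]
  over the 2-stack-sortable [w] in [S_n].

  The functional equation comes from [w = L m R].  If [R] or [L] is empty, we get the
  terms [t (1 + x) (1 + a)^2 (Q - Q(x,0)) / a] and [t (1 + x) a Q].  Otherwise, with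
  [s L = A a], the permutation [w] is 2-stack-sortable iff [L] and [R] are, all
  entries of [A] are below those of [R], and [a] splits [s R] at a cut [p]; so [w]
  amounts to [L], [R] standardized, together with [p].  The number of cuts of [s w] is
  that of [s L] plus the number of cuts of [s R] that are at least [p].  Summing
  [(1 + x)^(...)] over [p] gives a geometric sum, which is the quotient by [x]. *)

(** * Maxima, the decomposition [L m R] and the stack-sorting map *)

Lemma maxseq_ge (s : seq nat) x : x \in s -> x <= maxseq s.
Proof.
elim: s => //= y s IH; rewrite inE => /orP[/eqP->|/IH]; first exact: leq_maxl.
by move=> /leq_trans -> //; exact: leq_maxr.
Qed.

Lemma maxseq_in (s : seq nat) : s != [::] -> maxseq s \in s.
Proof.
elim: s => //= y [|z s] IH _; first by rewrite /= maxn0 inE.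
rewrite inE /maxn; case: ifP => _; last by rewrite eqxx.
by rewrite IH // orbT.
Qed.

Definition dominated (m : nat) (s : seq nat) := all (ltn^~ m) s.

Lemma maxseq_split L m R : dominated m L -> dominated m R ->
  maxseq (L ++ m :: R) = m.
Proof.
move=> /allP hL /allP hR; apply/anti_leq/andP; split; last first.
  by apply: maxseq_ge; rewrite mem_cat inE eqxx orbT.
have : maxseq (L ++ m :: R) \in L ++ m :: R by apply: maxseq_in; case: (L).
by rewrite mem_cat inE => /or3P[/hL/ltnW|/eqP->|/hR/ltnW].
Qed.

Lemma index_split L m R : dominated m L -> index m (L ++ m :: R) = size L.
Proof.
move=> /allP hL; rewrite index_cat /= eqxx addn0.
by case: ifP => // /hL /=; rewrite ltnn.
Qed.

Lemma max_split (s : seq nat) : uniq s -> s != [::] ->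
  exists (L : seq nat) (m : nat) (R : seq nat),
    [/\ s = L ++ m :: R, dominated m L & dominated m R].
Proof.
move=> us s0; have := @maxseq_ge s; have := maxseq_in s0.
move: (maxseq s) => m ms gs; case/splitPr: ms us gs => L R.
rewrite cat_uniq /= negb_or => /and4P[_ /andP[mL _] mR _] gs.
exists L, m, R; split=> //; apply/allP=> x xs /=;
rewrite ltn_neqAle gs ?mem_cat ?inE ?xs ?orbT // andbT.
  by apply: contraNneq mL => <-.
by apply: contraNneq mR => <-.
Qed.

(** The induction that follows the recursion of [ssort]: distinct entries put both sides of the
    maximum strictly below it. *)
Lemma max_ind (P : seq nat -> Prop) : P [::] ->
  (forall (L : seq nat) (m : nat) (R : seq nat), uniq L -> uniq R -> dominated m L -> dominated m R -> uniq (L ++ m :: R) ->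
     P L -> P R -> P (L ++ m :: R)) ->
  forall s : seq nat, uniq s -> P s.
Proof.
move=> P0 PS s; have [k] := ubnP (size s); elim: k s => // k IH s.
case: (eqVneq s [::]) => [->//|s0] sk us.
have [L [m [R [es mL mR]]]] := max_split us s0.
move: us sk; rewrite es size_cat /= => us sk; move: (us).
rewrite cat_uniq /= => /and4P[uL _ _ uR].
by apply: PS => //; apply: IH => //; lia.
Qed.

Lemma ssort_fuelS k p : p != [::] ->
  ssort_fuel k.+1 p = ssort_fuel k (take (index (maxseq p) p) p) ++
    ssort_fuel k (drop (index (maxseq p) p).+1 p) ++ [:: maxseq p].
Proof. by case: p. Qed.

Lemma ssort_fuel_eq k1 k2 p : size p <= k1 -> size p <= k2 ->
  ssort_fuel k1 p = ssort_fuel k2 p.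
Proof.
elim: k1 k2 p => [|k1 IH] [|k2] p; try by case: p.
have [->//|p0 h1 h2] := eqVneq p [::].
have ip : index (maxseq p) p < size p by rewrite index_mem maxseq_in.
rewrite !ssort_fuelS //.
by congr (_ ++ (_ ++ _)); apply: IH; rewrite ?size_take ?size_drop ?ip; lia.
Qed.

Lemma ssort_fuelE k p : size p <= k -> ssort_fuel k p = ssort p.
Proof. by move=> h; apply: ssort_fuel_eq. Qed.

Lemma ssort_split L m R : dominated m L -> dominated m R ->
  ssort (L ++ m :: R) = ssort L ++ ssort R ++ [:: m].
Proof.
move=> mL mR; rewrite {1}/ssort size_cat /= addnS ssort_fuelS; last by case: (L).
rewrite maxseq_split // index_split // take_size_cat //.
have -> : drop (size L).+1 (L ++ m :: R) = R.
  by rewrite -cat_rcons drop_size_cat ?size_rcons.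
by rewrite !ssort_fuelE // ?leq_addl ?leq_addr.
Qed.

Lemma ssort_perm (s : seq nat) : uniq s -> perm_eq (ssort s) s.
Proof.
elim/max_ind => // L m R _ _ mL mR _ IL IR; rewrite ssort_split //.
by apply: perm_cat => //; rewrite cats1 perm_rcons perm_cons.
Qed.

(** * One-stack-sortable words *)

(** [stack_sortable 3 p] unfolds to [sortable (ssort (ssort p))], and 2-stack-sortability of [s] is
    [sortable (ssort s)]. *)
Definition sortable (s : seq nat) := sorted ltn (ssort s).

Lemma sorted_ltn_cat (A B : seq nat) :
  sorted ltn (A ++ B) = [&& allrel ltn A B, sorted ltn A & sorted ltn B].
Proof. by rewrite !(sorted_pairwise ltn_trans) pairwise_cat. Qed.

Lemma dominated_allrel m s : dominated m s = allrel ltn s [:: m].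
Proof. by rewrite allrel1r. Qed.

Lemma dominated_cat m s1 s2 : dominated m (s1 ++ s2) = dominated m s1 && dominated m s2.
Proof. exact: all_cat. Qed.

Lemma dominated_cons m x s : dominated m (x :: s) = (x < m) && dominated m s.
Proof. by []. Qed.

Lemma sub_dominated m n s : m <= n -> dominated m s -> dominated n s.
Proof. by move=> mn; apply: sub_all => x /=; move/leq_trans; apply. Qed.

Lemma perm_dominated m s1 s2 : perm_eq s1 s2 -> dominated m s1 = dominated m s2.
Proof. exact: perm_all. Qed.

Lemma perm_allrel (A A' B B' : seq nat) : perm_eq A A' -> perm_eq B B' ->
  allrel ltn A B = allrel ltn A' B'.
Proof.
by move=> /perm_mem hA /perm_mem hB; rewrite (eq_allrel_meml _ _ hA) (eq_allrel_memr _ _ hB).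
Qed.

(** Since [ssort] only permutes entries, comparing [ssort L] with [ssort R] amounts to comparing [L]
    with [R]. *)
Lemma sortable_split (L : seq nat) m (R : seq nat) : uniq L -> uniq R ->
  dominated m L -> dominated m R ->
  sortable (L ++ m :: R) = [&& allrel ltn L R, sortable L & sortable R].
Proof.
move=> uL uR mL mR; rewrite /sortable ssort_split // catA sorted_ltn_cat -dominated_allrel.
rewrite dominated_cat !(perm_dominated _ (ssort_perm _)) // mL mR /= andbT.
by rewrite sorted_ltn_cat (perm_allrel (ssort_perm uL) (ssort_perm uR)).
Qed.

(* For [a] not in [B]: the entries below [a] precede those above it. *)
Definition admits (a : nat) (B : seq nat) := pairwise (fun x y => (a < x) ==> (a < y)) B.

Lemma admits_dominated a B : dominated a B -> admits a B.
Proof.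
rewrite /admits; elim: B => //= x B IH /andP[xa /[dup] aB /IH ->]; rewrite andbT.
by apply/allP=> y _; rewrite ltnNge (ltnW xa).
Qed.

(** By induction on the maximum [m] of [B]. If [a < m], then [m] is also the maximum of the whole
    word and the induction hypothesis applies to the part before it; if [m < a], the maximum is [a]
    and [admits a B] holds trivially. The intended use has [A a] and [B] equal to the images of [L]
    and [R]. *)
Lemma sortable_cat (A : seq nat) a (B : seq nat) : uniq (A ++ a :: B) -> dominated a A ->
  sortable (A ++ a :: B) = [&& sortable A, sortable B, allrel ltn A B & admits a B].
Proof.
move=> + aA; have [uB|nuB] := boolP (uniq B); last first.
  by rewrite cat_uniq /= (negbTE nuB) !andbF.
elim/max_ind: B / uB => [|B1 m B2 u1 u2 mB1 mB2 uB IH1 _] uAB.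
  have uA : uniq A by move: uAB; rewrite cat_uniq => /and3P[].
  by rewrite sortable_split // allrel0r /= andbT.
have uA : uniq A by move: uAB; rewrite cat_uniq => /and3P[].
have uAB1 : uniq (A ++ a :: B1).
  by move: uAB; rewrite -cat_cons catA cat_uniq => /and3P[].
have : a != m.
  by apply: contraTneq uAB => ->; rewrite cat_uniq /= mem_cat inE eqxx !orbT /= !andbF.
rewrite neq_ltn => /orP[am|ma].
  have mA := sub_dominated (ltnW am) aA.
  rewrite -cat_cons catA sortable_split //; last first.
    by rewrite dominated_cat mA dominated_cons am.
  rewrite IH1 // sortable_split // /admits pairwise_cat !allrel_catl !allrel_catr !allrel_consl !allrel_consr /=.
  have -> : all (fun x => (a < x) ==> (a < m)) B1.
    by apply/allP=> x _; rewrite am implybT.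
  (* Since [a < m], admitting [a] forces every entry after [m] above [a], which settles all pairs
     that involve [B2]. *)
  have -> : all (fun y => (a < m) ==> (a < y)) B2 = all (ltn a) B2.
    by apply: eq_all => y /=; rewrite am.
  rewrite [all (fun x => x < m) A]mA /=.
  have [h|_] := boolP (all (ltn a) B2); last by rewrite /= !andbF.
  have -> : allrel (fun x y => (a < x) ==> (a < y)) B1 B2.
    by apply/allrelP=> x y _ /(allP h) /= ->; rewrite implybT.
  have -> : pairwise (fun x y => (a < x) ==> (a < y)) B2.
    elim: (B2) h => //= y s IH /andP[_ h]; rewrite IH // andbT.
    by apply: sub_all h => z /= ->; rewrite implybT.
  rewrite /= !andbT; case: (allrel _ A B2); rewrite ?andbF ?andbT //=.
  case: (allrel _ B1 B2); rewrite ?andbF //=; case: (sortable A) => //=.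
  by case: (sortable B1); case: (sortable B2); rewrite ?andbF ?andbT.
have aB : dominated a (B1 ++ m :: B2).
  rewrite dominated_cat dominated_cons ma /=.
  by rewrite !(sub_dominated (ltnW ma)).
rewrite (@sortable_split A a) // ?admits_dominated // andbT.
by case: (allrel _ _ _); rewrite ?andbF ?andbT.
Qed.

(** * Cuts of a word *)

Definition is_cut (B : seq nat) i := allrel ltn (take i B) (drop i B).
(** The trivial cuts [0] and [size B] are included; the empty word has the single cut [0]. *)
Definition cuts (B : seq nat) := [seq i <- iota 0 (size B).+1 | is_cut B i].

Lemma mem_cuts B i : (i \in cuts B) = (i <= size B) && is_cut B i.
Proof. by rewrite mem_filter mem_iota /= ltnS andbC. Qed.

Lemma dominated_take m i B : dominated m B -> dominated m (take i B).
Proof. by rewrite -{1}(cat_take_drop i B) dominated_cat => /andP[]. Qed.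

Lemma dominated_drop m i B : dominated m B -> dominated m (drop i B).
Proof. by rewrite -{1}(cat_take_drop i B) dominated_cat => /andP[]. Qed.

(** A cut of [B] stays a cut, as [m] joins the upper side; the new one is the end of the word. *)
Lemma cuts_rcons B m : dominated m B -> size (cuts (B ++ [:: m])) = (size (cuts B)).+1.
Proof.
move=> mB; rewrite !size_filter size_cat addn1 -[(size B).+2]addn1 iotaD count_cat [count _ (iota _ 1)]/= addn0.
rewrite /is_cut take_oversize ?size_cat ?addn1 // drop_oversize ?size_cat ?addn1 //.
rewrite allrel0r addn1; congr _.+1; apply: eq_in_count => i.
rewrite mem_iota /= ltnS => iB.
rewrite take_cat drop_cat; case: ltngtP iB => // [iB _|-> _].
  by rewrite allrel_catr -dominated_allrel dominated_take // andbT.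
by rewrite subnn /= cats0 drop_size allrel0r -dominated_allrel mB.
Qed.

(** Once an entry exceeds [a], so do all later ones; hence the entries above [a] form the suffix
    that starts at [find (ltn a) B]. *)
Lemma admits_drop a B q : admits a B -> q <= size B ->
  all (ltn a) (drop q B) = (find (ltn a) B <= q).
Proof.
elim: B q => [|b B IH] [|q] //= /andP[hb hB] qB.
  have [ab|] := ltnP a b; last by [].
  by apply: sub_all hb => x /=; rewrite ab.
have [ab|] := boolP (a < b); last by rewrite ltnS IH.
apply/allP => x /mem_drop; move/allP: hb => /[apply]; by rewrite ab.
Qed.

Lemma take_find_ltn a B x : x \in take (find (ltn a) B) B -> x <= a.
Proof.
elim: B => //= b B IH; case: ifP => //= ab; rewrite inE.
by case/orP => [/eqP->|/IH//]; rewrite leqNgt ab.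
Qed.

Lemma find_is_cut a B : admits a B -> find (ltn a) B \in cuts B.
Proof.
move=> h; rewrite mem_cuts find_size /=; apply/allrelP=> x y /take_find_ltn xa.
have /allP hd : all (ltn a) (drop (find (ltn a) B) B) by rewrite admits_drop ?find_size.
by move=> /hd /=; apply: leq_trans; rewrite ltnS.
Qed.

(** A position inside [A] or just before [a] has [a] and [B] on its upper side. A position after [a]
    leaves [a] on the lower side, so the rest of [B] must exceed [a]; by [admits_drop] this bounds
    the cut of [B] from below by the place of [a]. *)
Lemma cuts_cat A a B : dominated a A -> allrel ltn A B -> admits a B ->
  size (cuts (A ++ a :: B)) = size (cuts A) + count (leq (find (ltn a) B)) (cuts B).
Proof.
move=> aA AB aB; rewrite !size_filter count_filter size_cat -addSn iotaD count_cat.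
congr (_ + _).
  apply: eq_in_count => i; rewrite mem_iota /= add0n ltnS => iA.
  rewrite /is_cut take_cat drop_cat; case: ltngtP iA => // [iA _|-> _]; last first.
    rewrite subnn /= cats0 drop_size allrel0r allrel_consr.
    by rewrite AB andbT [all _ _]aA.
  rewrite allrel_catr allrel_consr.
  have -> : allrel ltn (take i A) B.
    by apply/allrelP=> x y /mem_take xA yB; move/allrelP: AB; apply.
  by rewrite [all _ _](dominated_take i aA) !andbT.
rewrite add0n -[X in iota X](addn0) iotaDl count_map.
apply: eq_in_count => q; rewrite mem_iota /= add0n ltnS => qB.
rewrite /is_cut take_cat drop_cat.
have -> : ((size A).+1 + q < size A) = false by lia.
have -> : (size A).+1 + q - size A = q.+1 by lia.
rewrite /= allrel_catl allrel_consl.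
have -> : allrel ltn A (drop q B).
  by apply/allrelP=> x y xA /mem_drop yB; move/allrelP: AB; apply.
by rewrite /= admits_drop.
Qed.

(** * Invariance under order-preserving relabelling *)

Definition ltn_mono_on (f : nat -> nat) (s : seq nat) :=
  {in s &, {mono f : x y / x < y}}.

Lemma sub_ltn_mono_on f (s1 s2 : seq nat) : {subset s1 <= s2} ->
  ltn_mono_on f s2 -> ltn_mono_on f s1.
Proof. by move=> h hf x y /h hx /h hy; apply: hf. Qed.

Lemma ltn_mono_on_inj f s : ltn_mono_on f s -> {in s &, injective f}.
Proof.
move=> hf x y xs ys e; have := hf x y xs ys; have := hf y x ys xs.
by rewrite e ltnn; case: ltngtP.
Qed.

Lemma uniq_map_mono f (s : seq nat) : ltn_mono_on f s -> uniq (map f s) = uniq s.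
Proof. by move=> /ltn_mono_on_inj/map_inj_in_uniq. Qed.

Lemma dominated_map f m s : ltn_mono_on f (m :: s) -> dominated m s -> dominated (f m) (map f s).
Proof.
move=> hf /allP ms; rewrite /dominated all_map; apply/allP=> x xs /=.
by rewrite hf ?inE ?xs ?eqxx ?orbT //; apply: ms.
Qed.

Lemma allrel_map_mono f (A B : seq nat) : ltn_mono_on f (A ++ B) ->
  allrel ltn (map f A) (map f B) = allrel ltn A B.
Proof.
move=> hf; rewrite allrel_mapl allrel_mapr.
by apply/allrelP/allrelP => h x y xA yB; have := h x y xA yB;
  rewrite /= hf // mem_cat ?xA ?yB ?orbT.
Qed.

Lemma ssort_map f (s : seq nat) : uniq s -> ltn_mono_on f s ->
  ssort (map f s) = map f (ssort s).
Proof.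
elim/max_ind => // L m R uL uR mL mR uLR IL IR hf; rewrite map_cat /=.
rewrite !ssort_split ?map_cat /= ?IL ?IR //;
  first [apply: dominated_map => // | idtac]; apply: sub_ltn_mono_on hf => x;
  rewrite ?inE mem_cat inE; do ?[case/orP|move=> ->]; rewrite ?orbT //.
Qed.

Lemma sorted_map_mono f (s : seq nat) : ltn_mono_on f s -> sorted ltn (map f s) = sorted ltn s.
Proof.
move=> hf; rewrite sorted_map; apply: (@eq_in_sorted _ (mem s)); last exact/allP.
by move=> x y xs ys /=; apply: hf.
Qed.

Lemma sortable_map f (s : seq nat) : uniq s -> ltn_mono_on f s ->
  sortable (map f s) = sortable s.
Proof.
move=> us hf; rewrite /sortable ssort_map // sorted_map_mono //.
by apply: sub_ltn_mono_on hf => x; rewrite (perm_mem (ssort_perm us)).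
Qed.

Lemma cuts_map f (s : seq nat) : ltn_mono_on f s -> cuts (map f s) = cuts s.
Proof.
move=> hf; rewrite /cuts size_map; apply: eq_filter => i.
by rewrite /is_cut -map_take -map_drop allrel_map_mono // cat_take_drop.
Qed.

(** Sorting the two sides of the cut and joining them gives a sorted word, which can only be the
    interval; comparing prefixes identifies each side. *)
Lemma is_cut_iota k n (B : seq nat) p : perm_eq B (iota k n) -> p <= n -> is_cut B p ->
  perm_eq (take p B) (iota k p) /\ perm_eq (drop p B) (iota (k + p) (n - p)).
Proof.
move=> hB pn cp.
have szB : size B = n by rewrite (perm_size hB) size_iota.
have st : size (sort leq (take p B)) = p by rewrite size_sort size_takel // szB.
have E : sort leq (take p B) ++ sort leq (drop p B) = iota k p ++ iota (k + p) (n - p).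
  rewrite -iotaD subnKC //.
  apply: (sorted_eq leq_trans anti_leq).
  - rewrite (sorted_pairwise leq_trans) pairwise_cat -!(sorted_pairwise leq_trans).
    rewrite !sort_sorted ?andbT; try exact: leq_total.
    apply/allrelP=> x y; rewrite !mem_sort => xt yd; apply: ltnW.
    by move/allrelP: cp; apply.
  - exact: iota_sorted.
  - by rewrite -(permPr hB) -{3}(cat_take_drop p B) perm_cat // perm_sort.
have /eqP := E; rewrite eqseq_cat ?size_iota // => /andP[/eqP E1 /eqP E2].
by split; rewrite -?E1 -?E2 perm_sym perm_sort.
Qed.

(** * Divided differences of polynomials *)

Local Open Scope ring_scope.

Section DividedDifference.
Variable R : comNzRingType.
Implicit Types p q : {poly R}.

(** The exact quotient [(p - p(0)) / X]. *)
Definition divX p : {poly R} := drop_poly 1 p.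

Lemma divXE p : p = (p`_0)%:P + 'X * divX p.
Proof.
apply/polyP => i; rewrite coefD coefC coefXM coef_drop_poly.
by case: i => [|i]; rewrite /= ?addr0 ?add0r ?addn1.
Qed.

Lemma divX_eq p q c : p = c%:P + 'X * q -> divX p = q.
Proof.
move=> ->; apply/polyP => i; rewrite coef_drop_poly coefD coefC coefXM addn1 /=.
by rewrite add0r.
Qed.

Lemma coef0_divXE p : 'X * divX p = p - (p`_0)%:P.
Proof. by rewrite {2}(divXE p) addrAC subrr add0r. Qed.

Lemma divX_sum I (r : seq I) (P : pred I) (F : I -> {poly R}) :
  divX (\sum_(i <- r | P i) F i) = \sum_(i <- r | P i) divX (F i).
Proof. exact: raddf_sum. Qed.

Lemma divXZ c p : divX (c *: p) = c *: divX p.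
Proof. exact: linearZ. Qed.

Lemma divXXM p : divX ('X * p) = p.
Proof. by apply: (@divX_eq _ _ 0); rewrite polyC0 add0r. Qed.

End DividedDifference.

(** * The polynomial [Psi] and its convolution identity *)

Fixpoint Psi_fuel k (s : seq nat) : {poly int} :=
  if k is k'.+1 then
    if s == [::] then 1 + 'X else
    let i := index (maxseq s) s in
    divX (Psi_fuel k' (take i s)) *
      (if drop i.+1 s == [::] then (1 + 'X) ^+ 2 else 'X * Psi_fuel k' (drop i.+1 s))
  else 1 + 'X.

Definition Psi (s : seq nat) : {poly int} := Psi_fuel (size s) s.

Lemma Psi_fuel_eq k1 k2 s : (size s <= k1)%N -> (size s <= k2)%N ->
  Psi_fuel k1 s = Psi_fuel k2 s.
Proof.
elim: k1 k2 s => [|k1 IH] [|k2] s; try by case: s => //= x s; case: ifP.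
have [->//|s0 h1 h2 /=] := eqVneq s [::].
have ip : (index (maxseq s) s < size s)%N by rewrite index_mem maxseq_in.
rewrite (negbTE s0).
by congr (divX _ * _); [|case: ifP => // _; congr (_ * _)];
  apply: IH; rewrite ?size_take ?size_drop ?ip; lia.
Qed.

Lemma Psi_fuelE k s : (size s <= k)%N -> Psi_fuel k s = Psi s.
Proof. by move=> h; apply: Psi_fuel_eq. Qed.

Lemma Psi_nil : Psi [::] = 1 + 'X.
Proof. by []. Qed.

Lemma Psi_split L m R : dominated m L -> dominated m R ->
  Psi (L ++ m :: R) =
  divX (Psi L) * (if R == [::] then (1 + 'X) ^+ 2 else 'X * Psi R).
Proof.
move=> mL mR; rewrite {1}/Psi size_cat /= addnS /=.
have -> : (L ++ m :: R == [::]) = false by case: (L).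
rewrite maxseq_split // index_split // take_size_cat //.
have -> : drop (size L).+1 (L ++ m :: R) = R.
  by rewrite -cat_rcons drop_size_cat ?size_rcons.
by rewrite !Psi_fuelE // ?leq_addl ?leq_addr.
Qed.

Lemma Psi_map f (s : seq nat) : uniq s -> ltn_mono_on f s -> Psi (map f s) = Psi s.
Proof.
elim/max_ind => // L m R uL uR mL mR uLR IL IR hf; rewrite map_cat /=.
rewrite !Psi_split ?IL ?IR //;
  first [apply: dominated_map => // | idtac]; try (apply: sub_ltn_mono_on hf => x;
  rewrite ?inE mem_cat inE; do ?[case/orP|move=> ->]; rewrite ?orbT //).
by case: (R).
Qed.

(** For nonempty [R] the factor ['X] kills the constant term; for empty [R] the factor
    [(1 + 'X) ^+ 2] contributes [1]. *)
Lemma Psi_split0 L m R : dominated m L -> dominated m R ->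
  (Psi (L ++ m :: R))`_0 = if R == [::] then (divX (Psi L))`_0 else 0.
Proof.
move=> mL mR; rewrite Psi_split //; case: ifP => _; last by rewrite mulrCA coefXM.
by rewrite expr2 !coef0M coefD coef1 coefX /= addr0 !mulr1.
Qed.

(** By induction on the maximum, according to where [L m R] is broken. A break before [m] splits
    [L], and the recursion of [Psi] applies to the right factor. The break just after [m] gives the
    constant term of [Psi (L m)] times [Psi R]. A later break has a left factor that continues
    beyond [m], whose constant term is zero. *)
Lemma Psi_convolution (w : seq nat) : uniq w ->
  \sum_(0 <= i < (size w).+1) (Psi (take i w))`_0 *: Psi (drop i w) = (1 + 'X) * divX (Psi w).
Proof.
elim/max_ind => [|L m R uL uR mL mR uLR IL _].
  rewrite big_nat1 Psi_nil coefD coef1 coefX /= addr0 scale1r.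
  by rewrite (@divX_eq _ (1 + 'X) 1 1) ?mulr1.
set D := divX (Psi L); set g := if R == [::] then (1 + 'X) ^+ 2 else 'X * Psi R.
rewrite size_cat /= -addSn (big_cat_nat _ (n := (size L).+1)) ?leq_addr //=.
have -> : \sum_(0 <= i < (size L).+1)
    (Psi (take i (L ++ m :: R)))`_0 *: Psi (drop i (L ++ m :: R)) =
    divX (\sum_(0 <= i < (size L).+1) (Psi (take i L))`_0 *: Psi (drop i L)) * g.
  rewrite divX_sum mulr_suml; apply: eq_big_nat => i /andP[_]; rewrite ltnS => iL.
  have -> : take i (L ++ m :: R) = take i L by rewrite takel_cat.
  have -> : drop i (L ++ m :: R) = drop i L ++ m :: R.
    by rewrite drop_cat; case: ltngtP iL => // [->]; rewrite subnn drop_size.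
  by rewrite Psi_split ?dominated_drop // divXZ scalerAl.
rewrite IL -/D -{1}[(size L).+1]add0n big_addn addKn.
rewrite big_nat_recl // big1_seq => [|i /andP[_]]; last first.
  rewrite mem_index_iota => /andP[_ iR].
  have -> : take (i.+1 + (size L).+1) (L ++ m :: R) = L ++ m :: take i.+1 R.
    by rewrite take_cat; case: ltnP => [|_]; [lia|]; rewrite addnS -addSn addnK.
  rewrite Psi_split0 ?dominated_take //; case: R iR {mR uR uLR g} => //= *.
  by rewrite scale0r.
have -> : take (0 + (size L).+1) (L ++ m :: R) = L ++ [:: m].
  by rewrite take_cat add0n ltnNge leqnSn /= subSnn /= take0.
have -> : drop (0 + (size L).+1) (L ++ m :: R) = R.
  by rewrite drop_cat add0n ltnNge leqnSn /= subSnn /= drop0.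
rewrite Psi_split0 //= addr0 Psi_split // -/D -/g.
(* Both divided differences are computed from [D = c + X E]; hiding how [c] and [E] depend on [D]
   lets [D] be rewritten. *)
have [c [E [DE cD cE]]] : exists c E, [/\ D = c%:P + 'X * E, c = D`_0 & E = divX D].
  by exists D`_0, (divX D); split=> //; exact: divXE.
have -> : divX ((1 + 'X) * D) = D + E.
  by apply: (@divX_eq _ _ _ c); rewrite DE; ring.
rewrite -cD -mul_polyC /g; case: eqVneq => [->|_]; last first.
  by rewrite [D * _]mulrCA divXXM DE; ring.
(* For empty [R] the constant [c] is split off by [(1 + X)^2 = 1 + X (2 + X)]. *)
rewrite Psi_nil (@divX_eq _ (D * _) (E * (1 + 'X) ^+ 2 + c%:P * (1 + 1 + 'X)) c) DE; ring.
Qed.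

(** Applied below with [g] the position of the maximum. *)
Lemma big_fiber (V : nmodType) (T : Type) (s : seq T) (g : T -> nat) n (F : T -> V) :
  all (fun x => g x < n)%N s ->
  \sum_(x <- s) F x = \sum_(0 <= i < n) \sum_(x <- s | g x == i) F x.
Proof.
elim: s => [|x s IH] /=; first by rewrite big_nil big1 // => i _; rewrite big_nil.
case/andP=> xn /IH; rewrite big_cons => ->.
under [in RHS]eq_bigr => i _ do rewrite big_cons.
have Fx : F x = \sum_(0 <= i < n | g x == i) F x.
  by rewrite big_mkord (big_pred1 (Ordinal xn)) // => i; rewrite /= eq_sym.
rewrite {1}Fx big_mkcond -big_split /=.
by apply: eq_bigr => i _; case: ifP; rewrite ?add0r.
Qed.

(** * Counting the preimages under the stack-sorting map *)

(** For distinct entries every preimage of [w] is a rearrangement of [w], so filtering its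
    permutations loses none. *)
Definition ssort_preim (w : seq nat) := [seq p <- permutations w | ssort p == w].

Lemma ssort_preim_uniq w : uniq (ssort_preim w).
Proof. exact/filter_uniq/permutations_uniq. Qed.

Lemma mem_ssort_preim w p : uniq w -> (p \in ssort_preim w) = uniq p && (ssort p == w).
Proof.
move=> uw; rewrite mem_filter mem_permutations andbC.
have [E|] := eqVneq (ssort p) w; last by rewrite !andbF.
rewrite !andbT; apply/idP/idP => [/perm_uniq->//|up].
by rewrite -E perm_sym ssort_perm.
Qed.

(** As [ssort] preserves length, a preimage [x m y] of [w m] with [m] at position [i] has [ssort x]
    equal to the first [i] entries of [w] and [ssort y] equal to the rest. *)
Lemma ssort_preim_split (w : seq nat) m i : uniq w -> m \notin w -> dominated m w -> (i <= size w)%N ->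
  perm_eq [seq p <- ssort_preim (w ++ [:: m]) | index m p == i]
    [seq x ++ m :: y | x <- ssort_preim (take i w), y <- ssort_preim (drop i w)].
Proof.
move=> uw mw dw iw.
have uwm : uniq (w ++ [:: m]) by rewrite cats1 rcons_uniq mw.
have ut : uniq (take i w) by rewrite take_uniq.
have ud : uniq (drop i w) by rewrite drop_uniq.
have sz x : x \in ssort_preim (take i w) -> size x = i.
  by rewrite mem_ssort_preim // => /andP[/ssort_perm/perm_size <- /eqP->]; rewrite size_takel.
apply: uniq_perm.
- by rewrite filter_uniq ?ssort_preim_uniq.
- apply: allpairs_uniq; rewrite ?ssort_preim_uniq //.
  move=> [x y] [x' y'] /allpairsP[[? ?]] [/= /sz s1 _ [-> ->]].
  move=> /allpairsP[[? ?]] [/= /sz s2 _ [-> ->]] /eqP.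
  by rewrite eqseq_cat ?s1 ?s2 // eqseq_cons eqxx /= => /andP[/eqP-> /eqP->].
move=> p; rewrite mem_filter mem_ssort_preim //; apply/idP/allpairsP.
  case/and3P=> /eqP ip up /eqP sp.
  have p0 : p != [::] by apply: contra_eq_neq sp => ->; case: (w).
  have [L [m' [R [E mL mR]]]] := max_split up p0.
  move: ip up sp; rewrite {}E ssort_split // catA !cats1 => ip up /rcons_inj[E E'].
  subst m'; move: ip; rewrite index_split // => ip.
  move: up; rewrite cat_uniq /= => /and4P[uL _ _ uR].
  have si : size (ssort L) = i by rewrite (perm_size (ssort_perm uL)).
  exists (L, R); rewrite !mem_ssort_preim //= -E.
  by rewrite uL uR take_size_cat ?drop_size_cat // !eqxx.
case=> -[x y] /= []; rewrite !mem_ssort_preim // => /andP[ux /eqP sx] /andP[uy /eqP sy] ->.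
have px := ssort_perm ux; have py := ssort_perm uy; rewrite sx in px; rewrite sy in py.
have mx : dominated m x by rewrite -(perm_dominated _ px) dominated_take.
have my : dominated m y by rewrite -(perm_dominated _ py) dominated_drop.
rewrite index_split // -(perm_size px) size_takel // eqxx /= ssort_split // sx sy.
rewrite catA cat_take_drop eqxx andbT.
have : perm_eq (x ++ m :: y) (w ++ [:: m]).
  rewrite -cat1s perm_catCA /= cats1 perm_sym perm_rcons perm_cons.
  by rewrite -(cat_take_drop i w) perm_cat.
by move/perm_uniq ->.
Qed.

(** The induction is on the size, since the convolution involves all prefixes and suffixes of
    [L]. *)
Lemma size_ssort_preim (w : seq nat) : uniq w -> (Psi w)`_0 = (size (ssort_preim w))%:R.
Proof.
have [k] := ubnP (size w); elim: k w => // k IH w wk uw.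
have [->|w0] := eqVneq w [::].
  by rewrite Psi_nil coefD coef1 coefX addr0.
have [L [m [R [E mL mR]]]] := max_split uw w0.
move: uw wk; rewrite {w0}E => uw; rewrite size_cat /= => wk.
move: (uw); rewrite cat_uniq /= => /and4P[uL _ nR uR].
have mnL : m \notin L by apply/negP => /(allP mL) /=; rewrite ltnn.
rewrite Psi_split0 //; case: eqVneq => [R0|R0].
  (* The preimages of [L m], grouped by the position of [m], are counted by a convolution, which is
     the constant term of [Psi_convolution]. *)
  subst R; have := @Psi_convolution L uL => /(congr1 (fun q : {poly int} => q`_0)).
  rewrite mulrDl mul1r coefD coefXM addr0 => <-; rewrite coef_sum.
  rewrite -[size (ssort_preim _)]sum1_size natr_sum.
  rewrite (@big_fiber _ _ _ (index m) (size L).+1); last first.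
    apply/allP => p; rewrite mem_ssort_preim // => /andP[up /eqP sp].
    have := ssort_perm up; rewrite sp => pp.
    have szp : size p = (size L).+1 by rewrite -(perm_size pp) size_cat addn1.
    by rewrite -szp index_mem -(perm_mem pp) mem_cat inE eqxx orbT.
  apply: eq_big_nat => i /andP[_]; rewrite ltnS => iL.
  rewrite coefZ !IH ?take_uniq ?drop_uniq ?size_takel ?size_drop; try lia.
  rewrite -big_filter (perm_big _ (ssort_preim_split _ _ _ _)) //=.
  by rewrite big_const_seq count_predT size_allpairs iter_addr addr0 -natrM.
(* The image of a nonempty word ends with its maximum, so a nonempty [R] leaves no preimage. *)
suff -> : ssort_preim (L ++ m :: R) = [::] by [].
apply/eqP; rewrite -[_ == _]negbK -has_filter; apply/hasPn => p.
rewrite mem_permutations => pp; apply: contraNneq R0 => sp.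
have up : uniq p by rewrite (perm_uniq pp).
have p0 : p != [::] by rewrite -size_eq0 (perm_size pp) size_cat addnS.
have [L' [m' [R' [E mL' mR']]]] := max_split up p0.
have mp : m \in L' ++ m' :: R' by rewrite -E (perm_mem pp) mem_cat inE eqxx orbT.
move: sp; rewrite E ssort_split // => /(congr1 (last 0%N)).
rewrite !last_cat /= => em; case/lastP: R mR em {pp uw wk nR uR} => // R r.
rewrite last_rcons /dominated all_rcons => /andP[/= rm _] em; subst r.
move: mp; rewrite mem_cat inE => /or3P[/(allP mL')|/eqP e|/(allP mR')] /=.
- by rewrite ltnNge (ltnW rm).
- by rewrite e ltnn in rm.
- by rewrite ltnNge (ltnW rm).
Qed.

(** * 2-stack-sortability and cuts for [L m R] *)

Local Open Scope nat_scope.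

Lemma ssort_rcons (s : seq nat) : uniq s -> s != [::] ->
  exists2 A, ssort s = A ++ [:: maxseq s] & dominated (maxseq s) A.
Proof.
move=> us s0; have [L [m [R [E mL mR]]]] := max_split us s0.
move: us; rewrite E cat_uniq /= => /and4P[uL _ _ uR].
exists (ssort L ++ ssort R); rewrite maxseq_split //; first by rewrite ssort_split // catA.
by rewrite dominated_cat !(perm_dominated _ (ssort_perm _)) // mL mR.
Qed.

Lemma sortable_rcons (A : seq nat) a : uniq A -> dominated a A -> sortable (A ++ [:: a]) = sortable A.
Proof. by move=> uA dA; rewrite sortable_split // allrel0r andbT. Qed.

Lemma cat_uniq_split (L : seq nat) m R : uniq (L ++ m :: R) -> uniq (L ++ R) /\ m \notin L ++ R.
Proof. by rewrite -cat_rcons (perm_uniq (perm_cat (permEl (perm_rcons m L)) (perm_refl R))) => /andP[]. Qed.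

(** The maximum [m] ends up last, where it does not affect sortability. *)
Lemma sortable2_split (L : seq nat) m R : uniq (L ++ m :: R) -> dominated m L -> dominated m R ->
  sortable (ssort (L ++ m :: R)) = sortable (ssort L ++ ssort R).
Proof.
move=> /cat_uniq_split[]; rewrite cat_uniq => /and3P[uL hLR uR] _ mL mR.
have pL := ssort_perm uL; have pR := ssort_perm uR.
rewrite ssort_split // catA sortable_rcons //.
  rewrite cat_uniq (perm_uniq pL) (perm_uniq pR) uL uR andbT /=.
  by rewrite (eq_has_r (perm_mem pR)) (eq_has (perm_mem pL)).
by rewrite dominated_cat (perm_dominated _ pL) (perm_dominated _ pR) mL.
Qed.

(** This is [sortable_cat] for [ssort L = A a] and [ssort R]; as [a] is the maximum of [A a],
    sortability of [A] is that of [ssort L]. *)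
Lemma sortable2_catE (L : seq nat) m R A a : uniq (L ++ m :: R) -> dominated m L -> dominated m R ->
  ssort L = A ++ [:: a] -> dominated a A ->
  sortable (ssort (L ++ m :: R)) =
  [&& sortable (ssort L), sortable (ssort R), allrel ltn A R & admits a (ssort R)].
Proof.
move=> uLR mL mR sL aA; rewrite sortable2_split // sL -catA cat1s.
move: uLR => /cat_uniq_split[]; rewrite cat_uniq => /and3P[uL hLR uR] _.
have pL := ssort_perm uL; have pR := ssort_perm uR.
have uA : uniq A by move: uL; rewrite -(perm_uniq pL) sL cat_uniq => /and3P[].
rewrite sortable_cat // ?sortable_rcons // ?(perm_allrel (perm_refl A) pR) //.
rewrite -cat1s catA -sL cat_uniq (perm_uniq pL) (perm_uniq pR) uL uR andbT /=.
by rewrite (eq_has_r (perm_mem pR)) (eq_has (perm_mem pL)).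
Qed.

(** The final [m] adds one cut to [A a] followed by [ssort R], and [ssort L = A a] has one cut more
    than [A]; the two extra cuts match. *)
Lemma ncut_catE (L : seq nat) m R A a : uniq (L ++ m :: R) -> dominated m L -> dominated m R ->
  ssort L = A ++ [:: a] -> dominated a A -> allrel ltn A R -> admits a (ssort R) ->
  size (cuts (ssort (L ++ m :: R))) =
  size (cuts (ssort L)) + count (leq (find (ltn a) (ssort R))) (cuts (ssort R)).
Proof.
move=> uLR mL mR sL aA AR aR.
move: (uLR) => /cat_uniq_split[]; rewrite cat_uniq => /and3P[uL hLR uR] _.
have pL := ssort_perm uL; have pR := ssort_perm uR.
rewrite ssort_split // catA cuts_rcons; last first.
  by rewrite dominated_cat (perm_dominated _ pL) (perm_dominated _ pR) mL.
by rewrite sL -catA cat1s cuts_cat // ?cuts_rcons ?addSn // (perm_allrel (perm_refl A) pR).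
Qed.

(** * 2-stack-sortable permutations by the position of the maximum *)

Definition sortables2 n := [seq s <- permutations (iota 1 n) | sortable (ssort s)].

Lemma mem_sortables2 n s : (s \in sortables2 n) = sortable (ssort s) && perm_eq s (iota 1 n).
Proof. by rewrite mem_filter mem_permutations. Qed.

Lemma sortables2_uniq n : uniq (sortables2 n).
Proof. exact/filter_uniq/permutations_uniq. Qed.

Lemma iota1S n : iota 1 n.+1 = iota 1 n ++ [:: n.+1].
Proof. by have := iotaD 1 n 1; rewrite addn1 add1n. Qed.

Lemma perm_iota1S (L R : seq nat) n :
  perm_eq (L ++ n.+1 :: R) (iota 1 n.+1) = perm_eq (L ++ R) (iota 1 n).
Proof.
by rewrite iota1S -[n.+1 :: R]cat1s perm_catCA perm_sym perm_catC perm_sym perm_cat2l.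
Qed.

Lemma split_iota (L R : seq nat) n : perm_eq (L ++ n.+1 :: R) (iota 1 n.+1) ->
  [/\ uniq (L ++ n.+1 :: R), dominated n.+1 L, dominated n.+1 R & perm_eq (L ++ R) (iota 1 n)].
Proof.
move=> h; have u : uniq (L ++ n.+1 :: R) by rewrite (perm_uniq h) iota_uniq.
have hp : perm_eq (L ++ R) (iota 1 n) by rewrite -perm_iota1S.
have : dominated n.+1 (L ++ R).
  by rewrite (perm_dominated _ hp); apply/allP => x; rewrite mem_iota => /andP[].
by rewrite dominated_cat => /andP[].
Qed.

Lemma mem_sortables2_split n (s : seq nat) : s \in sortables2 n.+1 ->
  exists L R : seq nat, [/\ s = L ++ n.+1 :: R, dominated n.+1 L & dominated n.+1 R].
Proof.
rewrite mem_sortables2 => /andP[_ h].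
have : n.+1 \in s by rewrite (perm_mem h) iota1S mem_cat mem_seq1 eqxx orbT.
move=> ns; case/splitPr: ns h => L R /split_iota[].
by exists L, R.
Qed.

Lemma index_sortables2 n s : s \in sortables2 n.+1 -> index n.+1 s < n.+1.
Proof.
rewrite mem_sortables2 => /andP[_ h]; have szs := perm_size h; rewrite size_iota in szs.
by rewrite -[X in _ < X]szs index_mem (perm_mem h) iota1S mem_cat mem_seq1 eqxx orbT.
Qed.

Lemma sortables2_max_last n :
  perm_eq [seq s <- sortables2 n.+1 | index n.+1 s == n] [seq L ++ [:: n.+1] | L <- sortables2 n].
Proof.
apply: uniq_perm.
- exact/filter_uniq/sortables2_uniq.
- rewrite map_inj_uniq ?sortables2_uniq // => x y; rewrite !cats1 => e.
  by case: (rcons_inj e).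
move=> s; rewrite mem_filter; apply/andP/mapP.
  case=> /[swap] /[dup] sU /mem_sortables2_split[L [R [E mL mR]]].
  move: sU; rewrite mem_sortables2 {}E => /andP[h /[dup] p /split_iota[u _ _ p']].
  rewrite index_split // => /eqP sL.
  have R0 : R = [::].
    apply/size0nil/eqP; rewrite -(eqn_add2l n) addn0 -{1}sL -size_cat.
    by rewrite (perm_size p') size_iota.
  subst R; exists L => //; rewrite cats0 in p'.
  rewrite mem_sortables2 p' andbT.
  by move: h; rewrite sortable2_split // cats0.
case=> L; rewrite mem_sortables2 => /andP[h p] ->.
have p1 : perm_eq (L ++ [:: n.+1]) (iota 1 n.+1) by rewrite perm_iota1S cats0.
have [u mL mR _] := split_iota p1.
rewrite index_split // (perm_size p) size_iota eqxx mem_sortables2 p1 andbT; split=> //.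
by rewrite sortable2_split // cats0.
Qed.

Lemma sortables2_max_first n :
  perm_eq [seq s <- sortables2 n.+1 | index n.+1 s == 0] [seq n.+1 :: R | R <- sortables2 n].
Proof.
apply: uniq_perm.
- exact/filter_uniq/sortables2_uniq.
- by rewrite map_inj_uniq ?sortables2_uniq // => x y [].
move=> s; rewrite mem_filter; apply/andP/mapP.
  case=> /[swap] /[dup] sU /mem_sortables2_split[L [R [E mL mR]]].
  move: sU; rewrite mem_sortables2 {}E => /andP[h /[dup] p /split_iota[u _ _ p']].
  rewrite index_split // size_eq0 => /eqP L0; subst L; exists R => //.
  rewrite mem_sortables2 p' andbT.
  by move: h; rewrite sortable2_split.
case=> R; rewrite mem_sortables2 => /andP[h p] ->.
have p1 : perm_eq ([::] ++ n.+1 :: R) (iota 1 n.+1) by rewrite perm_iota1S.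
have [u mL mR _] := split_iota p1.
rewrite -[n.+1 :: R]/([::] ++ n.+1 :: R) index_split // eqxx mem_sortables2 p1 andbT; split=> //.
by rewrite sortable2_split.
Qed.

(** * Gluing two permutations along a cut, and its inverse *)

(* With [k.+1] the size of [L], the maximum of [L] becomes [k.+1 + p], its other
   entries keep the labels up to [k], and [R] fills the remaining labels. *)
Definition shift_left k p v := if v <= k then v else v + p.
Definition shift_right k p v := if v <= p then v + k else v + k.+1.
Definition glue n (t : seq nat * (seq nat * nat)) :=
  let: (L, (R, p)) := t in
  map (shift_left (size L).-1 p) L ++ n.+1 :: map (shift_right (size L).-1 p) R.

Definition unshift_right k a v := if v < a then v - k else v - k.+1.
(** The maximum of the left part has the label [k.+1 + p], which reveals [p]; [minn k.+1] lowers it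
    to [k.+1] and fixes the labels up to [k]. *)
Definition unglue k (s : seq nat) : seq nat * (seq nat * nat) :=
  let L := take k.+1 s in let a := maxseq L in
  (map (minn k.+1) L, (map (unshift_right k a) (drop k.+2 s), a - k.+1)).

Lemma shift_left_mono k p s : ltn_mono_on (shift_left k p) s.
Proof. by move=> x y _ _; rewrite /shift_left; case: ifP => ?; case: ifP => ?; lia. Qed.

Lemma shift_right_mono k p s : ltn_mono_on (shift_right k p) s.
Proof. by move=> x y _ _; rewrite /shift_right; case: ifP => ?; case: ifP => ?; lia. Qed.

Lemma shift_right_lt k p v : v <= p -> shift_right k p v < k.+1 + p.
Proof. by rewrite /shift_right => vp; rewrite vp addSn ltnS [k + p]addnC leq_add2r. Qed.

Lemma shift_right_gt k p v : p < v -> k.+1 + p < shift_right k p v.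
Proof. by rewrite /shift_right ltnNge => vp; rewrite (negbTE vp) [k.+1 + p]addnC ltn_add2r ltnNge. Qed.

Lemma shift_leftK k p v : v <= k.+1 -> minn k.+1 (shift_left k p v) = v.
Proof. by rewrite /shift_left; case: ifP; lia. Qed.

Lemma shift_rightK k p v : unshift_right k (k.+1 + p) (shift_right k p v) = v.
Proof.
rewrite /unshift_right; case: (leqP v p) => h.
  by rewrite shift_right_lt // /shift_right h addnK.
by rewrite ltnNge (ltnW (shift_right_gt _ h)) /= /shift_right [v <= p]leqNgt h addnK.
Qed.

(** Here [f] is the shift by [d - c], expressed without truncated subtraction. *)
Lemma map_shift_iota (f : nat -> nat) c d n : {in iota c n, forall x, f x + c = x + d} ->
  map f (iota c n) = iota d n.
Proof.
elim: n c d => //= n IH c d h; rewrite (IH _ d.+1).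
  by congr (_ :: _); have := h c; rewrite inE eqxx => /(_ isT); lia.
by move=> x xn; have := h x; rewrite inE xn orbT => /(_ isT); lia.
Qed.

Lemma perm_shift_left k p L : perm_eq L (iota 1 k.+1) ->
  perm_eq (map (shift_left k p) L) (iota 1 k ++ [:: k.+1 + p]).
Proof.
move=> /(perm_map (shift_left k p)) /permPl ->; rewrite iota1S map_cat /=.
rewrite (@map_shift_iota _ 1 1) /shift_left ?ltnn // => x.
by rewrite mem_iota; case: ifP; lia.
Qed.

Lemma perm_shift_right k p j R : p <= j -> perm_eq R (iota 1 j) ->
  perm_eq (map (shift_right k p) R) (iota k.+1 p ++ iota (k.+1 + p).+1 (j - p)).
Proof.
move=> pj /(perm_map (shift_right k p)) /permPl ->.
rewrite -{1}(subnKC pj) iotaD map_cat (@map_shift_iota _ 1 k.+1) => [|x].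
  rewrite (@map_shift_iota _ _ (k.+1 + p).+1) // => x.
  by rewrite mem_iota /shift_right; case: ifP; lia.
by rewrite mem_iota /shift_right; case: ifP; lia.
Qed.

Lemma find_ltn_cat a (B1 B2 : seq nat) : all (fun x => x < a) B1 -> all (ltn a) B2 ->
  find (ltn a) (B1 ++ B2) = size B1.
Proof.
elim: B1 => [|x B1 IH] /=; first by case: B2 => //= y B2 _ /andP[->].
by case/andP=> xa h1 h2; rewrite ltnNge (ltnW xa) /= IH.
Qed.

Lemma admits_cat a (B1 B2 : seq nat) : all (fun x => x < a) B1 -> all (ltn a) B2 ->
  admits a (B1 ++ B2).
Proof.
move=> h1 h2; rewrite /admits pairwise_cat [pairwise _ B1]admits_dominated //=.
have H2 : all (fun x => all (fun y => (a < x) ==> (a < y)) B2) B1.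
  apply/allP => x _; apply: sub_all h2 => y /= ->; exact: implybT.
apply/andP; split; first exact: H2.
elim: B2 h2 {H2} => //= y s IH /andP[_ h]; rewrite IH // andbT.
by apply: sub_all h => z /= ->; rewrite implybT.
Qed.

Section Glue.
Variables (n k j p : nat) (L R : seq nat).
Hypotheses (pL : perm_eq L (iota 1 k.+1)) (pR : perm_eq R (iota 1 j)).
Hypothesis cp : p \in cuts (ssort R).

Let uL : uniq L. Proof. by rewrite (perm_uniq pL) iota_uniq. Qed.
Let uR : uniq R. Proof. by rewrite (perm_uniq pR) iota_uniq. Qed.
Let L1 := map (shift_left k p) L.
Let R1 := map (shift_right k p) R.
Let sL : size L = k.+1. Proof. by rewrite (perm_size pL) size_iota. Qed.
Let sR : size R = j. Proof. by rewrite (perm_size pR) size_iota. Qed.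
Let pj : p <= j.
Proof. by move: cp; rewrite mem_cuts (perm_size (ssort_perm uR)) sR => /andP[]. Qed.
Let pL1 : perm_eq L1 (iota 1 k ++ [:: k.+1 + p]). Proof. exact: perm_shift_left. Qed.
Let pR1 : perm_eq R1 (iota k.+1 p ++ iota (k.+1 + p).+1 (j - p)). Proof. exact: perm_shift_right. Qed.

Lemma glueE : glue n (L, (R, p)) = L1 ++ n.+1 :: R1.
Proof. by rewrite /glue sL. Qed.

(** The left part takes the labels [1] to [k] and [k.+1 + p]; the right part takes those in between
    and those above. *)
Lemma glue_perm : n = k + j.+1 -> perm_eq (glue n (L, (R, p))) (iota 1 n.+1).
Proof.
move=> nE; rewrite glueE perm_iota1S (permPl (perm_cat pL1 pR1)) nE iotaD -catA perm_cat2l.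
have -> : iota (1 + k) j.+1 = iota k.+1 p ++ (k.+1 + p) :: iota (k.+1 + p).+1 (j - p).
  by rewrite -[_ :: iota _ _]/(iota (k.+1 + p) (j - p).+1) -iotaD -subSn // subnKC // ltnW.
by rewrite perm_catCA.
Qed.

Lemma maxseq_glue_left : maxseq L1 = k.+1 + p.
Proof.
apply/anti_leq/andP; split; last first.
  by apply: maxseq_ge; rewrite (perm_mem pL1) mem_cat mem_seq1 eqxx orbT.
have : maxseq L1 \in L1 by apply: maxseq_in; rewrite -size_eq0 size_map sL.
by rewrite (perm_mem pL1) mem_cat mem_iota mem_seq1; lia.
Qed.

(** These are the conditions of [sortable2_catE] and [ncut_catE] for the glued word. As [p] is a
    cut, the first [p] entries of [ssort R] are [1] to [p] in some order; they are moved below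
    [k.+1 + p] and the others above it. *)
Lemma glue_spec : exists A, [/\ ssort L1 = A ++ [:: k.+1 + p], dominated (k.+1 + p) A,
  allrel ltn A R1, admits (k.+1 + p) (ssort R1) & find (ltn (k.+1 + p)) (ssort R1) = p].
Proof.
have uL1 : uniq L1 by rewrite uniq_map_mono //; apply: shift_left_mono.
have L10 : L1 != [::] by rewrite -size_eq0 size_map sL.
have [A] := ssort_rcons uL1 L10; rewrite maxseq_glue_left => sA dA; exists A.
have pA : perm_eq A (iota 1 k).
  have := ssort_perm uL1; rewrite (permPr pL1) sA.
  by rewrite perm_cat2r.
have uR1 : uniq R1 by rewrite uniq_map_mono //; apply: shift_right_mono.
have pB := ssort_perm uR.
have [pt pd] : perm_eq (take p (ssort R)) (iota 1 p) /\ perm_eq (drop p (ssort R)) (iota (1 + p) (j - p)).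
  by apply: is_cut_iota; rewrite ?(permPl pB) //; move: cp; rewrite mem_cuts => /andP[].
have E : ssort R1 = map (shift_right k p) (take p (ssort R)) ++ map (shift_right k p) (drop p (ssort R)).
  by rewrite -map_cat cat_take_drop ssort_map //; apply: shift_right_mono.
have h1 : all (fun x => x < k.+1 + p) (map (shift_right k p) (take p (ssort R))).
  rewrite all_map; apply/allP => x; rewrite (perm_mem pt) mem_iota add1n ltnS => /andP[_].
  exact: shift_right_lt.
have h2 : all (ltn (k.+1 + p)) (map (shift_right k p) (drop p (ssort R))).
  rewrite all_map; apply/allP => x; rewrite (perm_mem pd) mem_iota add1n => /andP[+ _].
  exact: shift_right_gt.
split=> //.
- apply/allrelP => x y; rewrite (perm_mem pA) (perm_mem pR1) mem_cat !mem_iota add1n ltnS.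
  move=> /andP[_ xk] /orP[/andP[ky _]|/andP[ky _]]; first exact: leq_ltn_trans ky.
  by apply: leq_trans (ltnW ky); rewrite addSn ltnS (leq_trans xk) ?leq_addr.
- by rewrite E admits_cat.
- by rewrite E find_ltn_cat // size_map (perm_size pt) size_iota.
Qed.

Lemma unglueK : unglue k (glue n (L, (R, p))) = (L, (R, p)).
Proof.
have sL1 : size L1 = k.+1 by rewrite size_map.
rewrite /unglue glueE take_size_cat //.
have -> : drop k.+2 (L1 ++ n.+1 :: R1) = R1.
  by rewrite -cat_rcons drop_size_cat ?size_rcons ?sL1.
rewrite maxseq_glue_left addKn; congr (_, (_, _)).
  rewrite -map_comp; apply: map_id_in => x; rewrite (perm_mem pL) mem_iota add1n ltnS => /andP[_].
  exact: shift_leftK.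
by rewrite -map_comp; apply: map_id_in => x _; exact: shift_rightK.
Qed.

End Glue.

Lemma sortable2_map f (s : seq nat) : uniq s -> (forall t, ltn_mono_on f t) ->
  sortable (ssort (map f s)) = sortable (ssort s).
Proof.
move=> us hf; rewrite ssort_map // sortable_map //.
by rewrite (perm_uniq (ssort_perm us)).
Qed.

Definition glue_data k j : seq (seq nat * (seq nat * nat)) :=
  [seq (L, z) | L <- sortables2 k.+1, z <- [seq (R, p) | R <- sortables2 j, p <- cuts (ssort R)]].

Lemma mem_glue_data k j L R p : (L, (R, p)) \in glue_data k j =
  [&& L \in sortables2 k.+1, R \in sortables2 j & p \in cuts (ssort R)].
Proof.
apply/allpairsP/and3P => [[[L' z] /= [hL /allpairsPdep[R' [p' [hR hp ->]]] [-> -> ->]]]//|[hL hR hp]].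
exists (L, (R, p)); split=> //; apply/allpairsPdep; by exists R, p.
Qed.

Lemma glue_data_uniq k j : uniq (glue_data k j).
Proof.
apply: allpairs_uniq; first exact: sortables2_uniq; last by move=> [? ?] [? ?].
apply: allpairs_uniq_dep; first exact: sortables2_uniq.
- by move=> R _; rewrite filter_uniq ?iota_uniq.
- by move=> [R p] [R' p'] _ _ /= [-> ->].
Qed.

(** Besides membership, this gives injectivity of [glue], through the left inverse [unglue k]. *)
Lemma glue_mem n k j t : n = k + j.+1 -> t \in glue_data k j ->
  (glue n t \in sortables2 n.+1) && (index n.+1 (glue n t) == k.+1) && (unglue k (glue n t) == t).
Proof.
move=> nE; case: t => L [R p]; rewrite mem_glue_data !mem_sortables2.
case/and3P=> /andP[hL pL] /andP[hR pR] cp.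
have uL : uniq L by rewrite (perm_uniq pL) iota_uniq.
have uR : uniq R by rewrite (perm_uniq pR) iota_uniq.
have pg := glue_perm pL pR cp nE; rewrite (unglueK n pL pR cp) eqxx pg !andbT.
have [A [sL aA AR aR _]] := glue_spec pL pR cp.
move: pg; rewrite (glueE n p R pL) => /split_iota[u mL mR _].
rewrite (sortable2_catE u mL mR sL aA) AR aR !andbT !sortable2_map ?hL ?hR //=.
- by rewrite index_split // size_map (perm_size pL) size_iota.
- by move=> t; exact: shift_right_mono.
- by move=> t; exact: shift_left_mono.
Qed.

Lemma shift_unshift_left k q x : (x <= k) || (x == k.+1 + q) ->
  shift_left k q (minn k.+1 x) = x.
Proof.
rewrite /shift_left; case/orP => [xk|/eqP->]; first by rewrite (minn_idPr _) ?xk // leqW.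
by rewrite (minn_idPl _) ?leq_addr // ltnn.
Qed.

Lemma shift_unshift_right k q x : k < x -> x != k.+1 + q ->
  shift_right k q (unshift_right k (k.+1 + q) x) = x.
Proof.
rewrite /shift_right /unshift_right => kx; rewrite neq_ltn => /orP[h|h].
  by rewrite h leq_subLR; have -> : x <= k + q by []; rewrite subnK // ltnW.
by rewrite ltnNge (ltnW h) /= leqNgt ltn_subRL h /= subnK.
Qed.

(** The conditions of [sortable2_catE] determine the labels: [A] must carry [1] to [k], and the
    place of the maximum [a] of [L] among the entries of [R] fixes all others. *)
Lemma unglue_mem n k j s : n = k + j.+1 -> s \in sortables2 n.+1 -> index n.+1 s = k.+1 ->
  (unglue k s \in glue_data k j) /\ glue n (unglue k s) = s.
Proof.
move=> nE sU; have [L [R [E mL mR]]] := mem_sortables2_split sU.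
move: sU; rewrite mem_sortables2 {}E index_split // => /andP[h /split_iota[u _ _ pLR]] sL.
have [uLR _] := cat_uniq_split u; move: (uLR); rewrite cat_uniq => /and3P[uL hLR uR].
have L0 : L != [::] by rewrite -size_eq0 sL.
have [A sLA dA] := ssort_rcons uL L0; set a := maxseq L in sLA dA.
move: h; rewrite (sortable2_catE u mL mR sLA dA) => /and4P[hL hR AR aR].
have pL := ssort_perm uL; have pR := ssort_perm uR.
have aL : a \in L by exact: maxseq_in.
have aB : a \notin ssort R.
  by rewrite (perm_mem pR); apply: contra hLR => aR'; apply/hasP; exists a.
(* The cut to be recovered is the place at which [a] fits into [ssort R]. *)
have cq := find_is_cut aR; set q := find _ _ in cq.
have sA : size A = k.
  by have := perm_size pL; rewrite sLA size_cat sL addn1 => -[].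
have sR : size R = j.
  have := perm_size pLR; rewrite size_cat sL size_iota nE addSnnS => /eqP.
  by rewrite eqn_add2l => /eqP[].
(* All of [A] lies below [a] and [R], so [k] is a cut of [A a R]. *)
have [pA paR] : perm_eq A (iota 1 k) /\ perm_eq (a :: R) (iota k.+1 j.+1).
  have [] := @is_cut_iota 1 n (A ++ a :: R) k; last 1 first.
  - by rewrite -sA take_size_cat // drop_size_cat // sA nE addKn add1n.
  - apply: perm_trans pLR; rewrite -cat1s catA perm_cat2r -sLA; exact: pL.
  - by rewrite nE leq_addr.
  - by rewrite /is_cut -sA take_size_cat // drop_size_cat // allrel_consr [all _ _]dA.
have qj : q <= j by rewrite -sR -(perm_size pR) find_size.
(* Once [a] is inserted into [ssort R] at position [q], that position is a cut of a word on the
   labels [k.+1] to [n]. *)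
have [pt pad] : perm_eq (take q (ssort R)) (iota k.+1 q) /\
    perm_eq (a :: drop q (ssort R)) (iota (k.+1 + q) (j - q).+1).
  have st : size (take q (ssort R)) = q by rewrite size_takel ?find_size.
  have := @is_cut_iota k.+1 j.+1 (take q (ssort R) ++ a :: drop q (ssort R)) q.
  rewrite /is_cut take_size_cat // drop_size_cat // subSn //; apply.
  - by rewrite -cat1s perm_catCA cat_take_drop -(permPr paR) perm_cons.
  - exact: leqW.
  - rewrite allrel_consr; move: cq; rewrite mem_cuts => /andP[_ cq].
    rewrite [allrel _ _ (drop _ _)]cq andbT; apply/allP => x xt /=.
    rewrite ltn_neqAle (take_find_ltn xt) andbT.
    by apply: contraNneq aB => <-; exact: mem_take xt.
(* Everything after [a] exceeds it, so [a] is the least label of the upper interval. *)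
have ea : a = k.+1 + q.
  have [] := is_cut_iota pad (isT : 1 <= _.+1); last first.
    by rewrite /= take0 => /perm_mem/(_ a); rewrite !mem_seq1 eqxx => /esym/eqP.
  by rewrite /is_cut /= take0 drop0 allrel1l admits_drop // (perm_size pR) sR.
have pB : perm_eq R (iota k.+1 q ++ iota (k.+1 + q).+1 (j - q)).
  rewrite -(permPl pR) -{1}(cat_take_drop q (ssort R)) perm_cat //.
  by move: pad; rewrite ea perm_cons.
have pL0 : perm_eq L (iota 1 k ++ [:: k.+1 + q]).
  by rewrite -(permPl pL) sLA -ea perm_cat2r.
have eL : take k.+1 (L ++ n.+1 :: R) = L by rewrite take_size_cat.
have eR : drop k.+2 (L ++ n.+1 :: R) = R.
  by rewrite -cat_rcons drop_size_cat ?size_rcons ?sL.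
have eu : unglue k (L ++ n.+1 :: R) = (map (minn k.+1) L, (map (unshift_right k a) R, q)).
  by rewrite /unglue eL eR -/a {2}ea addKn.
have sLs : map (shift_left k q) (map (minn k.+1) L) = L.
  rewrite -map_comp; apply: map_id_in => x; rewrite (perm_mem pL0) mem_cat mem_iota mem_seq1 => h.
  by apply: shift_unshift_left; case/orP: h => [/andP[_]|->]; rewrite ?orbT // add1n ltnS => ->.
have sRs : map (shift_right k q) (map (unshift_right k a) R) = R.
  rewrite -map_comp; apply: map_id_in => x xR; rewrite /= ea; apply: shift_unshift_right.
    by move: xR; rewrite (perm_mem pB) mem_cat !mem_iota => /orP[/andP[]//|/andP[h _]];
    rewrite (leq_trans _ (ltnW h)) // ltnS leq_addr.
  by rewrite -ea; apply: contraNneq aB => <-; rewrite (perm_mem pR).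
have pL' : perm_eq (map (minn k.+1) L) (iota 1 k.+1).
  rewrite (permPl (perm_map _ pL0)) map_cat iota1S /= (minn_idPl _) ?leq_addr //.
  rewrite (@map_shift_iota _ 1 1) // => x; rewrite mem_iota add1n ltnS => /andP[_ xk].
  by rewrite (minn_idPr _) // leqW.
have pR' : perm_eq (map (unshift_right k a) R) (iota 1 j).
  rewrite (permPl (perm_map _ pB)) map_cat -{2}(subnKC qj) iotaD.
  rewrite (@map_shift_iota _ _ 1) => [|x].
    rewrite (@map_shift_iota _ _ (1 + q)) // => x.
    rewrite mem_iota /unshift_right ea => /andP[h _].
    rewrite ltnNge (ltnW h) /= -addnS addnA subnK //.
    exact: leq_trans (leq_addr _ _) (ltnW h).
  rewrite mem_iota /unshift_right ea => /andP[kx ->].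
  by rewrite addnS subnK ?addn1 // ltnW.
rewrite eu; split; last by rewrite (glueE n q _ pL') sLs sRs.
rewrite mem_glue_data !mem_sortables2 pL' pR' !andbT.
have uL' : uniq (map (minn k.+1) L) by rewrite (perm_uniq pL') iota_uniq.
have uR' : uniq (map (unshift_right k a) R) by rewrite (perm_uniq pR') iota_uniq.
(* The shifts undo the unshifts, so sortability and the cut pass to the standardized parts. *)
rewrite -(sortable2_map uL' (shift_left_mono k q)) sLs hL.
rewrite -(sortable2_map uR' (shift_right_mono k q)) sRs hR /=.
rewrite -(@cuts_map (shift_right k q)); last exact: shift_right_mono.
by rewrite -ssort_map // ?sRs //; exact: shift_right_mono.
Qed.

Lemma sortables2_max_middle n k j : n = k + j.+1 ->
  perm_eq [seq s <- sortables2 n.+1 | index n.+1 s == k.+1] [seq glue n t | t <- glue_data k j].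
Proof.
move=> nE; apply: uniq_perm.
- exact/filter_uniq/sortables2_uniq.
- rewrite map_inj_in_uniq ?glue_data_uniq // => t t' tD t'D e.
  have /andP[_ /eqP <-] := glue_mem nE tD.
  by have /andP[_ /eqP <-] := glue_mem nE t'D; rewrite e.
move=> s; rewrite mem_filter; apply/andP/mapP.
  by case=> /eqP si sU; have [h e] := unglue_mem nE sU si; exists (unglue k s).
by case=> t tD ->; have /andP[/andP[-> ->] _] := glue_mem nE tD.
Qed.

(** * Weights of 2-stack-sortable permutations *)

Local Open Scope ring_scope.

(** [Psi] is a polynomial in [a] and [ypow] one in [x]. As [R2] has [a] as outer variable, the
    former is embedded coefficientwise and the latter as a constant. *)
Definition cst (p : {poly int}) : R2 := map_poly polyC p.
Definition ypow n : {poly int} := (1 + 'X) ^+ n.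
Definition weight (s : seq nat) : R2 := cst (Psi s) * (ypow (size (cuts (ssort s))))%:P.

Lemma cst_divX p : cst (divX p) = divX (cst p).
Proof. by apply/polyP=> i; rewrite coef_map !coef_drop_poly coef_map. Qed.

Lemma cstM : {morph cst : p q / p * q}. Proof. exact: rmorphM. Qed.

Lemma cstX : cst 'X = varA. Proof. exact: map_polyX. Qed.

Lemma cst_onePX : cst ((1 + 'X) ^+ 2) = (1 + varA) ^+ 2.
Proof. by rewrite /cst rmorphXn rmorphD rmorph1 /= map_polyX. Qed.

Lemma ypowS n : (ypow n.+1)%:P = (1 + varX) * (ypow n)%:P.
Proof. by rewrite /ypow exprS polyCM polyCD. Qed.

Lemma ypowD m n : ypow (m + n) = ypow m * ypow n. Proof. exact: exprD. Qed.

Lemma divXMC (R : comNzRingType) (p : {poly R}) c : divX (p * c%:P) = divX p * c%:P.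
Proof. by rewrite ![_ * c%:P]mulrC !mul_polyC divXZ. Qed.

Lemma divX_cst1 : divX (cst (1 + 'X)) = 1.
Proof. by apply: (@divX_eq _ _ _ 1); rewrite /cst rmorphD rmorph1 /= map_polyX mulr1. Qed.

Lemma weight_max_last L m : uniq L -> dominated m L ->
  weight (L ++ [:: m]) = (1 + varX) * (divX (weight L) * (1 + varA) ^+ 2).
Proof.
move=> uL mL; rewrite /weight Psi_split //= ssort_split //= cuts_rcons.
  by rewrite ypowS divXMC cstM cst_onePX cst_divX; ring.
by rewrite (perm_dominated _ (ssort_perm uL)).
Qed.

Lemma weight_max_first R m : uniq R -> R != [::] -> dominated m R ->
  weight (m :: R) = (1 + varX) * varA * weight R.
Proof.
move=> uR R0 mR; rewrite /weight -[m :: R]/([::] ++ m :: R) Psi_split // (negbTE R0).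
rewrite ssort_split //= cuts_rcons; last by rewrite (perm_dominated _ (ssort_perm uR)).
rewrite ypowS !cstM cst_divX cstX.
by rewrite divX_cst1; ring.
Qed.

(** As [p] runs through [s], the count runs down from [size s] to [1], so this is a geometric
    sum. *)
Lemma sum_count_leq (s : seq nat) : sorted ltn s ->
  \sum_(p <- s) ypow (count (leq p) s) = (1 + 'X) * \sum_(i < size s) ypow i.
Proof.
rewrite (sorted_pairwise ltn_trans).
elim: s => [|x s IH] /=; first by rewrite big_nil big_ord0 mulr0.
case/andP=> /allP xs ps; rewrite big_cons /= leqnn.
have -> : count (leq x) s = size s.
  by apply/eqP; rewrite -all_count; apply/allP => z /xs /ltnW.
rewrite (eq_big_seq (fun p => ypow (count (leq p) s))); last first.
  by move=> p /xs /= xp; rewrite leqNgt xp.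
by rewrite IH // big_ord_recr /= mulrDr addrC [in RHS]/ypow -exprS.
Qed.

Lemma sorted_cuts B : sorted ltn (cuts B).
Proof. by apply: sorted_filter; [exact: ltn_trans|exact: iota_ltn_sorted]. Qed.

(** The condition [0 < j] makes [R] nonempty, which selects the factor ['X * Psi R] in [Psi_split].
    The number of cuts splits by [ncut_catE], and [weight L] absorbs the share of [L]. *)
Lemma weight_glue n k j L R p : n = (k + j.+1)%N -> (0 < j)%N -> (L, (R, p)) \in glue_data k j ->
  weight (glue n (L, (R, p))) =
  divX (weight L) * (varA * (cst (Psi R) * (ypow (count (leq p) (cuts (ssort R))))%:P)).
Proof.
move=> nE j0; rewrite mem_glue_data !mem_sortables2 => /and3P[/andP[_ pL] /andP[_ pR] cp].
have uL : uniq L by rewrite (perm_uniq pL) iota_uniq.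
have uR : uniq R by rewrite (perm_uniq pR) iota_uniq.
have R0 : R != [::] by rewrite -size_eq0 (perm_size pR) size_iota -lt0n.
have [A [sL aA AR aR fp]] := glue_spec pL pR cp.
have := glue_perm pL pR cp nE; rewrite (glueE n p R pL) => /split_iota[u mL mR _].
rewrite {1}/weight Psi_split // (ncut_catE u mL mR sL aA AR aR) fp.
rewrite -size_eq0 size_map size_eq0 (negbTE R0).
have mono_l t := @shift_left_mono k p t; have mono_r t := @shift_right_mono k p t.
rewrite !Psi_map // !ssort_map // !cuts_map // ypowD polyCM.
rewrite divXMC !cstM cst_divX cstX.
by ring.
Qed.

(** * The series [Q] and its functional equation *)

(** The empty word is left out, since the equation forces the coefficient of [t^0] to vanish. *)
Definition Qser : series := fun n => if n is 0 then 0 else \sum_(s <- sortables2 n) weight s.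
Definition D1ser : series := fun n => divX (Qser n).
(** The inner sum is [((1 + x)^c - 1) / x] for [c] the number of cuts. *)
Definition D2ser : series := fun n => if n is 0 then 0 else
  \sum_(s <- sortables2 n) cst (Psi s) * (\sum_(i < size (cuts (ssort s))) ypow i)%:P.

Lemma D1serE n : varA * D1ser n = Qser n - at_a0 Qser n.
Proof. exact: coef0_divXE. Qed.

Lemma D2serE n : varX * D2ser n = Qser n - at_x0 Qser n.
Proof.
(* Written as a ring morphism, evaluation at [x = 0] passes through the sum and the product. *)
have -> : at_x0 Qser n = map_poly (polyC \o horner_eval 0) (Qser n) by exact: eq_map_poly.
case: n => [|n]; first by rewrite /= mulr0 rmorph0 subr0.
rewrite /D2ser /Qser rmorph_sum mulr_sumr -sumrB /=; apply: eq_bigr => s _.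
rewrite rmorphM /= map_polyC /= /cst -map_poly_comp.
rewrite [X in _ - X * _](_ : _ = cst (Psi s)); last first.
  by apply: eq_map_poly => c /=; rewrite /horner_eval hornerC.
rewrite /horner_eval /ypow horner_exp hornerD hornerC hornerX addr0 expr1n.
rewrite -mulrBr -polyCB mulrCA -polyCM; congr (_ * _%:P).
by rewrite subrX1 addrAC subrr add0r.
Qed.

Lemma Qser_max_last n : (0 < n)%N ->
  \sum_(s <- sortables2 n.+1 | index n.+1 s == n) weight s =
  (1 + varX) * (D1ser n * (1 + varA) ^+ 2).
Proof.
case: n => // n _.
rewrite -big_filter (perm_big _ (sortables2_max_last _)) /= big_map.
rewrite /D1ser /Qser divX_sum mulr_suml mulr_sumr; apply: eq_big_seq => L.
rewrite mem_sortables2 => /andP[_ pL]; have uL : uniq L by rewrite (perm_uniq pL) iota_uniq.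
rewrite weight_max_last // (perm_dominated _ pL).
by apply/allP => x; rewrite mem_iota => /andP[].
Qed.

Lemma Qser_max_first n : (0 < n)%N ->
  \sum_(s <- sortables2 n.+1 | index n.+1 s == 0%N) weight s = (1 + varX) * varA * Qser n.
Proof.
case: n => // n _.
rewrite -big_filter (perm_big _ (sortables2_max_first _)) /= big_map.
rewrite mulr_sumr; apply: eq_big_seq => R.
rewrite mem_sortables2 => /andP[_ pR]; have uR : uniq R by rewrite (perm_uniq pR) iota_uniq.
rewrite weight_max_first //; first by rewrite -size_eq0 (perm_size pR).
by rewrite (perm_dominated _ pR); apply/allP => x; rewrite mem_iota => /andP[].
Qed.

(** For fixed [L] and [R], summing over the cuts [p] turns the power of [1 + x] into [1 + x] times
    the geometric sum of [D2ser]. *)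
Lemma Qser_max_middle n k j : n = (k + j.+1)%N -> (0 < j)%N ->
  \sum_(s <- sortables2 n.+1 | index n.+1 s == k.+1) weight s =
  (1 + varX) * (D1ser k.+1 * (varA * D2ser j)).
Proof.
move=> nE j0; rewrite -big_filter (perm_big _ (sortables2_max_middle nE)) /= big_map.
rewrite (eq_big_seq (fun t => divX (weight t.1) * (varA *
  (cst (Psi t.2.1) * (ypow (count (leq t.2.2) (cuts (ssort t.2.1))))%:P)))); last first.
  by move=> [L [R p]] tD; exact: weight_glue nE j0 tD.
rewrite /glue_data big_allpairs /D1ser /Qser divX_sum mulr_suml mulr_sumr.
case: j nE j0 => // j _ _; apply: eq_bigr => L _; rewrite big_allpairs_dep /= !mulr_sumr.
apply: eq_bigr => R _; rewrite -!mulr_sumr -rmorph_sum /= sum_count_leq ?sorted_cuts //.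
by rewrite polyCM polyCD -/varX; ring.
Qed.

Lemma Qser1 : Qser 1 = (varX + 1) ^+ 2 * (1 + varA) ^+ 2.
Proof.
rewrite /Qser /sortables2 big_filter big_cons big_nil /=.
rewrite addr0 (@weight_max_last [::]) // /weight divXMC divX_cst1 mul1r.
(* The empty word has one cut, which gives the second factor [1 + x]. *)
rewrite -[ssort _]/[::] -[size _]/1%N /ypow expr1 polyCD -/varX; ring.
Qed.

(** The maximum is first, last or strictly between. For [0 < n] the first and last positions differ,
    and in the third case both sides are nonempty. *)
Lemma Qser_rec n : (0 < n)%N ->
  Qser n.+1 = (1 + varX) * (\sum_(k < n.-1) D1ser k.+1 * (varA * D2ser (n - k.+1)%N))
    + (1 + varX) * (D1ser n * (1 + varA) ^+ 2) + (1 + varX) * varA * Qser n.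
Proof.
case: n => // n _; rewrite {1}/Qser.
rewrite (@big_fiber _ _ _ (index n.+2) n.+2); last exact/allP/index_sortables2.
rewrite big_nat_recl // Qser_max_first // big_nat_recr //= Qser_max_last // [LHS]addrC.
congr (_ + _ + _); rewrite big_mkord mulr_sumr.
apply: eq_bigr => k _; apply: Qser_max_middle.
  by rewrite subSS addnS subnKC // ltnW.
by rewrite subSS subn_gt0.
Qed.

Lemma D1ser0 : D1ser 0 = 0.
Proof. by apply: (@divX_eq _ _ _ 0); rewrite mulr0 addr0. Qed.

Lemma Qser_Qeq : Qeq Qser.
Proof.
exists D1ser, D2ser; split; [exact: D1serE|split; [exact: D2serE|]].
(* The coefficients of [t^0] and [t^1] are checked directly; from [t^2] on the equation is
   [Qser_rec]. *)
case=> [|[|n]]; first by rewrite /= mul0r addr0.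
  by rewrite Qser1 /= /smul big_ord1 D1ser0 !(mul0r, mulr0, addr0) mul1r.
rewrite Qser_rec //= mul0r add0r; congr (_ + _).
rewrite -mulrDr; congr (_ * _).
(* The first term of the product vanishes with [D1ser 0]; in the last one the second factor has
   index [0] and is [(1 + a)^2], as [D2ser 0] is zero. *)
rewrite /smul big_ord_recl big_ord_recr /=.
rewrite D1ser0 mul0r add0r /bump /= add1n subnn mulr0 addr0 mul1r; congr (_ + _).
apply: eq_bigr => k _; rewrite add1n; congr (_ * _).
have -> : (n.+1 - k.+1 == 0)%N = false by rewrite subSS subn_eq0 leqNgt ltn_ord.
by rewrite mul0r add0r.
Qed.

(** * Uniqueness, and the count of 3-stack-sortable permutations *)

(** The factor [t] makes each coefficient depend only on lower ones, and [a] and [x] can be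
    cancelled, so that [Q] determines both quotients. *)
Lemma Qeq_unique Q Q' : Qeq Q -> Qeq Q' -> Q =1 Q'.
Proof.
move=> [D1 [D2 [h1 [h2 h3]]]] [D1' [D2' [h1' [h2' h3']]]].
move=> n; have [m] := ubnP n; elim: m n => // m IH n nm.
have eD1 i : (i < n)%N -> D1 i = D1' i.
  move=> i_n; have e : Q i = Q' i by apply: IH; exact: leq_trans i_n _.
  apply: (@mulfI _ varA); first by rewrite /varA polyX_eq0.
  by rewrite h1 h1' /at_a0 e.
have eD2 i : (i < n)%N -> D2 i = D2' i.
  move=> i_n; have e : Q i = Q' i by apply: IH; exact: leq_trans i_n _.
  apply: (@mulfI _ varX); first by rewrite /varX polyC_eq0 polyX_eq0.
  by rewrite h2 h2' /at_x0 e.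
rewrite h3 h3'; congr (_ + _); case: n nm eD1 eD2 => // n nm eD1 eD2 /=.
rewrite (IH n) //; congr (_ * _ + _); apply: eq_bigr => i _.
by rewrite eD1 // eD2 // ltnS leq_subr.
Qed.

(** A permutation is 3-stack-sortable iff its image under [ssort] is 2-stack-sortable, so the count
    is grouped by that image. *)
Lemma w_sum n : w n = (\sum_(s <- sortables2 n) size (ssort_preim s))%N.
Proof.
rewrite /w -sum1_count big_mkcond /=.
have E p : p \in permutations (iota 1 n) ->
    (if stack_sortable 3 p then 1 else 0)%N = (\sum_(s <- sortables2 n | ssort p == s) 1)%N.
  rewrite mem_permutations => pp; have up : uniq p by rewrite (perm_uniq pp) iota_uniq.
  rewrite sum1_count (eq_count (a2 := pred1 (ssort p))) => [|s]; last by rewrite /= eq_sym.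
  rewrite count_uniq_mem ?sortables2_uniq // mem_sortables2.
  by rewrite (permPl (ssort_perm up)) pp andbT -[stack_sortable 3 p]/(sortable _); case: sortable.
rewrite (eq_big_seq _ E) (exchange_big_dep xpredT) //=; apply: eq_big_seq => s.
rewrite mem_sortables2 => /andP[_ ps]; rewrite sum1_count -size_filter.
apply/perm_size/perm_filter; rewrite perm_sym; exact: perm_permutations.
Qed.

Theorem theorem2p1 :
  exists Q : series,
    Qeq Q /\
    (forall Q' : series, Qeq Q' -> Q' = Q) /\
    (forall n : nat, coef00 Q n = (if (n == 0)%N then 0 else (w n)%:Z)%R).
Proof.
exists Qser; split; first exact: Qser_Qeq.
split=> [Q' hQ'|[|n]]; last 2 first.
- by rewrite /coef00 /= coef0 horner0.
- rewrite /coef00 /= w_sum coef_sum horner_sum.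
  rewrite -natz natr_sum; apply: eq_big_seq => s; rewrite mem_sortables2 => /andP[_ ps].
  (* Setting [a = 0] leaves the number of preimages of [s], and setting [x = 0] turns the power of
     [1 + x] into [1]. *)
  rewrite /weight coefMC coef_map /= size_ssort_preim ?(perm_uniq ps) ?iota_uniq //.
  rewrite hornerM hornerC /ypow horner_exp hornerD hornerC hornerX addr0 expr1n mulr1.
  by [].
apply: functional_extensionality; exact: (Qeq_unique hQ' Qser_Qeq).
Qed.
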